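(* There is an algorithm which, for any finite partially ordered set $\langle P,\le\rangle$, computes an optimum basis of the convex geometry $\mathrm{Co}(P)$ of order convex subsets of $P$ from its canonical basis $\Sigma_C$ in time polynomial in $s(\Sigma_C)$.
   Context: All sets are finite. For a poset $\langle P,\le\rangle$, a subset $Y\subseteq P$ is (order) convex if $a\le c\le b$ and $a,b\in Y$ imply $c\in Y$. $\mathrm{Co}(P)$ denotes the closure system $\langle P,\phi\rangle$ where $\phi(X)$ is the smallest convex subset of $P$ containing $X\subseteq P$; it is a convex geometry. An implication $X\to Y$ is an ordered pair of nonempty disjoint subsets of the base set. A set $\Sigma$ of implications defines the closure system whose closed sets are the $Z$ such that for all $(X\to Y)\in\Sigma$, $X\subseteq Z$ implies $Y\subseteq Z$. A basis of a closure system is a set of implications defining it. The size is $s(\Sigma)=\sum_{(X\to Y)\in\Sigma}(|X|+|Y|)$, and a basis is optimum if its size is minimum among all bases of the closure system. Canonical basis of a closure system $\langle G,\phi\rangle$: $Q\subseteq G$ is quasi-closed if it is not closed and $Q\cap X$ is closed for every closed $X$ with $Q\not\subseteq X$. A quasi-closed $C$ is critical if whenever $Q\subseteq C$ is quasi-closed and $\phi(Q)=\phi(C)$, then $Q=C$. With $\mathcal C$ the set of critical sets, $\Sigma_C=\{C\to\phi(C)\setminus C: C\in\mathcal C\}$. For $\mathrm{Co}(P)$ the canonical basis consists of the implications $\{x,y\}\to Z$ with $x<y$ in $P$ and $Z=\{z\in P: x<z<y\}\neq\emptyset$. *)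

(* Defs.v *)
From mathcomp Require Import all_boot all_order all_algebra.

Set Implicit Arguments.
Unset Strict Implicit.
Unset Printing Implicit Defensive.

Section ClosureSystems.

Variable T : finType.

(* A closure system on T is given by its closure operator phi. *)
Implicit Types (phi : {set T} -> {set T}) (X Q C Z : {set T}).

Definition is_closed phi Z : bool := phi Z == Z.

(* The pair (X, Y) stands for X -> Y. *)
Definition is_implication (i : {set T} * {set T}) : bool :=
  [&& i.1 != set0, i.2 != set0 & [disjoint i.1 & i.2]].

Definition respects (Sigma : {set {set T} * {set T}}) Z : bool :=
  [forall i in Sigma, (i.1 \subset Z) ==> (i.2 \subset Z)].

Definition is_basis phi (Sigma : {set {set T} * {set T}}) : Prop :=
  (forall i, i \in Sigma -> is_implication i) /\
  (forall Z, is_closed phi Z = respects Sigma Z).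

Definition basis_size (Sigma : {set {set T} * {set T}}) : nat :=
  \sum_(i in Sigma) (#|i.1| + #|i.2|).

Definition is_optimum_basis phi (Sigma : {set {set T} * {set T}}) : Prop :=
  is_basis phi Sigma /\
  (forall Sigma', is_basis phi Sigma' -> basis_size Sigma <= basis_size Sigma').

Definition quasi_closed phi Q : bool :=
  ~~ is_closed phi Q &&
  [forall X, is_closed phi X ==> ~~ (Q \subset X) ==> is_closed phi (Q :&: X)].

Definition critical phi C : bool :=
  quasi_closed phi C &&
  [forall Q : {set T},
     [&& Q \subset C, quasi_closed phi Q & phi Q == phi C] ==> (Q == C)].

Definition canonical_basis phi : {set {set T} * {set T}} :=
  [set (C, phi C :\: C) | C in [set C | critical phi C]].

End ClosureSystems.

Section OrderConvexSubsets.

Variables (d : Order.disp_t) (P : finPOrderType d).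

Definition order_convex (Y : {set P}) : bool :=
  [forall a in Y, forall b in Y, forall c, (a <= c <= b)%O ==> (c \in Y)].

(* Order-convex sets are stable under intersection, so this is the smallest
   convex set containing X. *)
Definition Co (X : {set P}) : {set P} :=
  \bigcap_(Y : {set P} | order_convex Y && (X \subset Y)) Y.

End OrderConvexSubsets.

(* Model of computation: Jones's WHILE language ("Computability and Complexity
   from a Programming Perspective", 1997) on binary trees with nil and atom
   leaves.  Atoms can only be copied and compared with one another, at unit
   cost, and a program contains no atoms.  Hence one program serves for all
   sets A of atoms, and running times are measured in numbers of elements
   rather than in bits of some naming of the elements.  Unit-cost cons is
   justified by representing trees with shared pointers; over finitely many
   atoms the language has the same polynomial-time problems as Turing
   machines. *)

Inductive tree (A : Type) : Type :=
  | Nil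
  | Atom of A
  | Cons of tree A & tree A.
Arguments Nil {A}.

Inductive expr : Type :=
  | EVar of nat
  | ENil
  | ECons of expr & expr
  | EHd of expr
  | ETl of expr
  | ESameAtom of expr & expr.

Inductive cmd : Type :=
  | CAssign of nat & expr
  | CSeq of cmd & cmd
  | CIf of expr & cmd & cmd
  | CWhile of expr & cmd.

Section Semantics.

Variable A : eqType.

Definition store : Type := nat -> tree A.

Definition update (s : store) (x : nat) (v : tree A) : store :=
  fun y => if y == x then v else s y.

Definition truthy (v : tree A) : bool := if v is Nil then false else true.

Fixpoint eval (s : store) (e : expr) : tree A :=
  match e with
  | EVar x => s x
  | ENil => Nil
  | ECons e1 e2 => Cons (eval s e1) (eval s e2)
  | EHd e1 => if eval s e1 is Cons u _ then u else Nil
  | ETl e1 => if eval s e1 is Cons _ v then v else Nil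
  | ESameAtom e1 e2 =>
      match eval s e1, eval s e2 with
      | Atom a, Atom b => if a == b then Cons Nil Nil else Nil
      | _, _ => Nil
      end
  end.

(* Evaluation never branches, so its time does not depend on the store. *)
Fixpoint expr_time (e : expr) : nat :=
  match e with
  | EVar _ | ENil => 1
  | EHd e1 | ETl e1 => (expr_time e1).+1
  | ECons e1 e2 | ESameAtom e1 e2 => (expr_time e1 + expr_time e2).+1
  end.

(* exec c s t s': started in store s, c halts after t steps in store s'. *)
Inductive exec : cmd -> store -> nat -> store -> Prop :=
  | ExecAssign x e s :
      exec (CAssign x e) s (expr_time e).+1 (update s x (eval s e))
  | ExecSeq c1 c2 s s1 s2 t1 t2 :
      exec c1 s t1 s1 -> exec c2 s1 t2 s2 ->
      exec (CSeq c1 c2) s (t1 + t2).+1 s2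
  | ExecIf e c1 c2 s s1 t :
      exec (if truthy (eval s e) then c1 else c2) s t s1 ->
      exec (CIf e c1 c2) s (expr_time e + t).+1 s1
  | ExecWhileFalse e c s :
      ~~ truthy (eval s e) ->
      exec (CWhile e c) s (expr_time e).+1 s
  | ExecWhileTrue e c s s1 s2 t1 t2 :
      truthy (eval s e) ->
      exec c s t1 s1 -> exec (CWhile e c) s1 t2 s2 ->
      exec (CWhile e c) s (expr_time e + t1 + t2).+1 s2.

(* The input is placed in variable 0, and the output is read there too. *)
Definition init_store (v : tree A) : store := fun x => if x is 0 then v else Nil.
Definition output (s : store) : tree A := s 0.

Definition tree_of_seq (l : seq (tree A)) : tree A := foldr (@Cons A) Nil l.

Definition tree_of_implications (l : seq (seq A * seq A)) : tree A :=
  tree_of_seq [seq Cons (tree_of_seq (map (@Atom A) i.1))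
                        (tree_of_seq (map (@Atom A) i.2)) | i <- l].

End Semantics.

Definition implication_of_seqs (T : finType) (i : seq T * seq T) :
  {set T} * {set T} := ([set x in i.1], [set x in i.2]).

(* v lists each implication of Sigma, and each element of its two sides,
   exactly once, in an arbitrary order. *)
Definition encodes (T : finType) (v : tree T) (Sigma : {set {set T} * {set T}}) :
  Prop :=
  exists l : seq (seq T * seq T),
    [/\ v = tree_of_implications l,
        all (fun i => uniq i.1 && uniq i.2) l,
        uniq (map (@implication_of_seqs T) l) &
        Sigma = [set i in map (@implication_of_seqs T) l]].

(* Main.v *)
From mathcomp Require Import all_boot all_order all_algebra.
From mathcomp Require Import zify.
Require Import Defs.

(** The critical sets of [Co(P)] are the pairs [{x, y}] with [x < y] and a
    nonempty open interval [(x, y)], so the canonical basis consists of the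
    implications [{x, y} -> (x, y)] ([canonical_basisP]).  The left sides cannot
    be made smaller, and the right sides can be shrunk independently of each
    other: it is enough to keep one element of each connected component of the
    comparability graph of [(x, y)].

    Enough: if [b] has been derived and [c] in [(x, y)] is comparable to [b],
    then [c] lies in one of the intervals [(x, b)] and [(b, y)], which are
    smaller than [(x, y)] and hence already derivable by induction.  So whole
    components are reached ([respects_interval]).

    Necessary: let [K] be a component of [(x, y)].  The interval [[x, y]]
    without [K] is not convex, so an arbitrary basis has an implication [X -> Y]
    such that [X] is included in [[x, y]] and avoids [K], whereas [Y] meets [K].
    As removing [x] or [y] as well would leave a convex set, [X] contains both
    [x] and [y] ([basis_meets_component]).  The implications with [{x, y}]
    included in [X] and [X] included in [[x, y]] are different for different
    pairs ([within_inj]); one of them has left side [{x, y}]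
    ([basis_contains_pair]), and together their right sides meet all components.
    Thus they weigh at least as much as the shrunk implication
    ([basis_weight_lower_bound]), and summing over all pairs gives optimality
    ([shrunk_basis_optimum]).

    The order is not part of the input, but its restriction to each [(x, y)] can
    be read off the canonical basis: for [b] and [c] in [(x, y)], [b < c] holds
    iff [c] occurs in the conclusion of [{b, y}], and [c < b] iff it occurs in
    that of [{x, b}].  So two distinct elements [b] and [c] are comparable iff some
    implication has [b] on its left and [c] on its right ([linkedE]).  The
    components are then found by inserting the elements of [(x, y)] one by one
    into a list of disjoint blocks, merging the blocks that contain a neighbour
    of the new element ([representatives_pick_components]).

    The program is a nest of loops over lists.  Each list is a part of the input,
    a block or a list of blocks, and so not longer than the size of the canonical
    basis.  The running time is therefore bounded by a polynomial
    ([runs_optimum_program], [optimum_program_time_poly]). *)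

Set Implicit Arguments.
Unset Strict Implicit.
Unset Printing Implicit Defensive.
Import Order.TTheory.

(** * Time-bounded runs of commands *)

Fixpoint writes (c : cmd) : seq nat :=
  match c with
  | CAssign x _ => [:: x]
  | CSeq c1 c2 | CIf _ c1 c2 => writes c1 ++ writes c2
  | CWhile _ c1 => writes c1
  end.

Section Runs.

Variable A : eqType.
Implicit Types (s : store A) (c : cmd) (e : expr) (Q : store A -> Prop).

Definition agree_off (ws : seq nat) s s' : Prop :=
  forall z, z \notin ws -> s' z = s z.

Lemma exec_frame c s t s' : exec c s t s' -> agree_off (writes c) s s'.
Proof.
elim=> {c s t s'} //=.
- by move=> x e s z; rewrite inE /update => /negbTE ->.
- move=> c1 c2 s s1 s2 t1 t2 _ IH1 _ IH2 z; rewrite mem_cat negb_or.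
  by case/andP=> z1 z2; rewrite IH2 ?IH1.
- move=> e c1 c2 s s1 t _ IH z; rewrite mem_cat negb_or => /andP[z1 z2].
  by apply: IH; case: ifP.
- by move=> e c s s1 s2 t1 t2 _ _ IH1 _ IH2 z zc; rewrite IH2 ?IH1.
Qed.

(** Total correctness with a time bound.  Carrying the frame condition inside
    [runs] lets every later proof recover the untouched registers by computing
    [writes]. *)
Definition runs c s T Q : Prop :=
  exists t s', [/\ exec c s t s', t <= T, agree_off (writes c) s s' & Q s'].

Lemma runs_weaken c s T T' Q Q' :
  runs c s T Q -> T <= T' ->
  (forall s', agree_off (writes c) s s' -> Q s' -> Q' s') -> runs c s T' Q'.
Proof.
move=> [t [s' [ex tT fr Qs]]] TT' QQ'.
by exists t, s'; split=> //; [exact: leq_trans TT' | exact: QQ'].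
Qed.

Lemma runs_assign x e s T Q :
  expr_time e < T -> Q (update s x (eval s e)) -> runs (CAssign x e) s T Q.
Proof.
move=> eT Qs; have ex := ExecAssign x e s.
by exists (expr_time e).+1, (update s x (eval s e)); split=> //; exact: exec_frame ex.
Qed.

Lemma runs_seq c1 c2 s T1 T2 Q1 Q :
  runs c1 s T1 Q1 ->
  (forall s1, agree_off (writes c1) s s1 -> Q1 s1 -> runs c2 s1 T2 Q) ->
  runs (CSeq c1 c2) s (T1 + T2).+1 Q.
Proof.
move=> [t1 [s1 [ex1 tT1 fr1 Qs1]]] /(_ s1 fr1 Qs1)[t2 [s2 [ex2 tT2 fr2 Qs2]]].
have ex := ExecSeq ex1 ex2; exists (t1 + t2).+1, s2; split=> //.
  by rewrite ltnS leq_add.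
exact: exec_frame ex.
Qed.

Lemma runs_if e c1 c2 s T Q :
  runs (if truthy (eval s e) then c1 else c2) s T Q ->
  runs (CIf e c1 c2) s (expr_time e + T).+1 Q.
Proof.
move=> [t [s' [ex tT fr Qs]]]; have ex' := ExecIf ex.
exists (expr_time e + t).+1, s'; split=> //; first by rewrite ltnS leq_add2l.
exact: exec_frame ex'.
Qed.

(** The traversed list is copied to [l] and consumed there, so the list denoted by
    [e] survives the loop. *)
Definition foreach x l e c : cmd :=
  CSeq (CAssign l e)
    (CWhile (EVar l) (CSeq (CAssign x (EHd (EVar l)))
                           (CSeq (CAssign l (ETl (EVar l))) c))).

(** [et] is the cost of evaluating the traversed expression, [n] a bound on its
    length and [T] on the cost of the body.  The 10 extra steps per round pay for
    the test, the two assignments and the sequencing. *)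
Definition loop_time et n T : nat := n * (T + 10) + et + 4.

(** A loop whose body updates the accumulator [r] by [f] computes a left fold.
    The body may assume which prefix [pre] has been processed, because the
    length of the accumulator, on which the cost of the body may depend, is
    bounded through [pre]. *)
Lemma runs_foreach (X S : Type) (encX : X -> tree A) (encS : S -> tree A)
    (f : S -> X -> S) x l r e c s (xs : seq X) acc N T :
    [&& x != l, r != l, r != x & l \notin writes c] ->
    eval s e = tree_of_seq (map encX xs) -> size xs <= N ->
    s r = encS acc ->
    (forall pre y post s0, xs = pre ++ y :: post ->
       agree_off (r :: writes (foreach x l e c)) s s0 ->
       s0 x = encX y -> s0 r = encS (foldl f acc pre) ->
       runs c s0 T (fun s1 => s1 r = encS (f (foldl f acc pre) y))) ->
  runs (foreach x l e c) s (loop_time (expr_time e) N T)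
       (fun s' => s' r = encS (foldl f acc xs)).
Proof.
case/and4P=> xl rl rx lc es szN sr body.
pose L := CWhile (EVar l) (CSeq (CAssign x (EHd (EVar l)))
                           (CSeq (CAssign l (ETl (EVar l))) c)).
suff loop : forall post pre s0, xs = pre ++ post ->
    agree_off (r :: writes (foreach x l e c)) s s0 ->
    s0 l = tree_of_seq (map encX post) -> s0 r = encS (foldl f acc pre) ->
    runs L s0 (size post * (T + 10) + 2) (fun s' => s' r = encS (foldl f acc xs)).
  have := @runs_seq (CAssign l e) L s (expr_time e).+1 (size xs * (T + 10) + 2)
    (fun s1 => s1 l = tree_of_seq (map encX xs) /\ s1 r = encS acc)
    (fun s' => s' r = encS (foldl f acc xs)).
  case.
  - by apply: runs_assign => //; rewrite /update eqxx (negbTE rl).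
  - move=> s1 fr [s1l s1r]; apply: (loop xs [::]) => // z.
    rewrite /= !inE !negb_or => /and3P[_ zl _]; apply: fr.
    by rewrite inE.
  move=> t [s' [ex tT fr Qs]]; exists t, s'; split=> //.
  apply: leq_trans tT _; rewrite /loop_time.
  have := leq_mul szN (leqnn (T + 10)); lia.
elim=> [|y post IH] pre s0 exs fr s0l s0r.
  have ex : exec L s0 2 s0 by apply: ExecWhileFalse; rewrite /= s0l.
  by exists 2, s0; split=> //; rewrite exs cats0.
pose s1 := update s0 x (encX y).
pose s2 := update s1 l (tree_of_seq (map encX post)).
have ex1 : exec (CAssign x (EHd (EVar l))) s0 3 s1.
  by have := ExecAssign x (EHd (EVar l)) s0; rewrite /= s0l.
have ex2 : exec (CAssign l (ETl (EVar l))) s1 3 s2.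
  have := ExecAssign l (ETl (EVar l)) s1.
  by rewrite /= [s1 l]/update eq_sym (negbTE xl) s0l.
have fr2 : agree_off (r :: writes (foreach x l e c)) s s2.
  move=> z zw; move: (zw); rewrite /= !inE !negb_or => /and5P[_ zl zx _ _].
  by rewrite /s2 /s1 /update (negbTE zl) (negbTE zx) fr.
have s2x : s2 x = encX y by rewrite /s2 /s1 /update (negbTE xl) eqxx.
have s2r : s2 r = encS (foldl f acc pre).
  by rewrite /s2 /s1 /update (negbTE rl) (negbTE rx).
have [t3 [s3 [ex3 t3T fr3 s3r]]] := body pre y post s2 exs fr2 s2x s2r.
have [||||t4 [s4 [ex4 t4T fr4 s4r]]] := IH (rcons pre y) s3.
- by rewrite cat_rcons.
- move=> z zw; rewrite fr3 ?fr2 //.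
  by move: zw; rewrite /= !inE !negb_or => /and5P[].
- by rewrite fr3 // /s2 /update eqxx.
- by rewrite foldl_rcons.
have ex : exec L s0 (1 + (3 + (3 + t3).+1).+1 + t4).+1 s4.
  apply: (@ExecWhileTrue _ (EVar l)) ex4; first by rewrite /= s0l.
  exact: ExecSeq ex1 (ExecSeq ex2 ex3).
exists (1 + (3 + (3 + t3).+1).+1 + t4).+1, s4; split=> //; first by rewrite [size _]/= mulSn; lia.
exact: exec_frame ex.
Qed.

End Runs.

(** * Connected components by merging blocks *)

Section Blocks.

Variables (T : eqType) (adj : rel T).
Implicit Types (a b c : T) (C : seq T) (K : seq (seq T)) (Z : seq T).

(** The folds below have the shape of the loops of the program.  During the
    insertion of [a], the head of [K] is the block under construction, which
    collects [a] and the blocks adjacent to it; the tail holds the other ones. *)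
Definition push K c : seq (seq T) := (c :: head [::] K) :: behead K.

Definition merge a K C : seq (seq T) :=
  if has (adj a) C then foldl push K C else head [::] K :: C :: behead K.

Definition absorb K a : seq (seq T) := foldl (merge a) [:: [:: a]] K.

Definition blocks Z : seq (seq T) := foldl absorb [::] Z.

Definition representatives Z : seq T := pmap ohead (blocks Z).

Lemma foldl_push C K D : foldl push (D :: K) C = catrev C D :: K.
Proof. by elim: C D => //= c C IH D; rewrite IH. Qed.

Lemma foldl_merge a D E K :
  foldl (merge a) (D :: E) K =
  catrev (flatten [seq C <- K | has (adj a) C]) D ::
  catrev [seq C <- K | ~~ has (adj a) C] E.
Proof.
elim: K D E => //= C K IH D E; rewrite {2}/merge.
case: ifP => aC /=; last by rewrite IH.
by rewrite foldl_push IH -catrev_catl.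
Qed.

Lemma absorbE K a :
  absorb K a = catrev (flatten [seq C <- K | has (adj a) C]) [:: a] ::
               rev [seq C <- K | ~~ has (adj a) C].
Proof. exact: foldl_merge. Qed.

Lemma perm_flatten_absorb K a : perm_eq (flatten (absorb K a)) (a :: flatten K).
Proof.
rewrite absorbE /= catrevE -catA perm_catCA /= perm_cons.
apply: perm_trans (perm_flatten (permEl (perm_filterC (has (adj a)) K))).
rewrite flatten_cat; apply: perm_cat; first by rewrite perm_rev.
by apply: perm_flatten; rewrite perm_rev.
Qed.

Lemma perm_flatten_blocks Z : perm_eq (flatten (blocks Z)) Z.
Proof.
elim/last_ind: Z => // Z a IH; rewrite /blocks foldl_rcons -/(blocks Z).
apply: perm_trans (perm_flatten_absorb _ _) _.
by rewrite perm_sym perm_rcons perm_cons perm_sym.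
Qed.

Lemma nil_notin_blocks Z : [::] \notin blocks Z.
Proof.
elim/last_ind: Z => // Z a IH; rewrite /blocks foldl_rcons -/(blocks Z) absorbE.
rewrite inE mem_rev mem_filter /= negb_or IH andbT.
by rewrite eq_sym -size_eq0 catrevE size_cat addn1.
Qed.

Lemma size_blocks Z : size (blocks Z) <= size Z.
Proof.
rewrite -[leqRHS](perm_size (perm_flatten_blocks Z)).
have := nil_notin_blocks Z; elim: (blocks Z) => //= C K IH.
rewrite inE negb_or size_cat => /andP[C0 /IH]; case: C C0 => //= c C _; lia.
Qed.

Lemma size_block Z C : C \in blocks Z -> size C <= size Z.
Proof.
rewrite -[leqRHS](perm_size (perm_flatten_blocks Z)).
elim: (blocks Z) => //= D K IH; rewrite inE size_cat => /predU1P[-> | /IH]; lia.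
Qed.

(** Blocks are not too large: merging only ever joins elements linked by [adj],
    hence stays inside each equivalence relation that contains [adj]. *)
Lemma block_rel (R : rel T) Z : equivalence_rel R ->
  {in Z &, forall b c, adj b c -> R b c} ->
  {in blocks Z, forall C, {in C &, forall b c, R b c}}.
Proof.
move=> eqR.
have Rxx b : R b b by case: (eqR b b b).
have Rr b c d : R b c -> R b d = R c d by move=> bc; case: (eqR b c d) => _ ->.
elim/last_ind: Z => // Z a IH adjR.
have {}IH : {in blocks Z, forall C, {in C &, forall b c, R b c}}.
  by apply: IH => b c bZ cZ; apply: adjR; rewrite mem_rcons inE ?bZ ?cZ orbT.
move=> C; rewrite /blocks foldl_rcons -/(blocks Z) absorbE inE mem_rev mem_filter.
case/predU1P=> [-> | /andP[_ /IH //]].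
have Ra b : b \in catrev (flatten [seq C <- blocks Z | has (adj a) C]) [:: a] -> R a b.
  rewrite catrevE mem_cat mem_rev inE => /orP[|/eqP-> //].
  case/flattenP=> D; rewrite mem_filter => /andP[/hasP[c cD ac] DZ] bD.
  have cZ : c \in Z.
    by rewrite -(perm_mem (perm_flatten_blocks Z)); apply/flattenP; exists D.
  have Rac : R a c by apply: adjR; rewrite // mem_rcons inE ?eqxx ?cZ ?orbT.
  by rewrite (Rr _ _ b Rac) (IH D).
by move=> b c /Ra ab /Ra ac; rewrite -(Rr _ _ _ ab).
Qed.

(** Blocks are not too small: when the later of two adjacent elements is
    inserted, the block of the earlier one is merged with it.  Symmetry is needed as
    the test is only made from the side of the later element. *)
Lemma adj_block Z : {in Z &, symmetric adj} ->
  {in Z &, forall b c, adj b c ->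
     exists2 C, C \in blocks Z & (b \in C) && (c \in C)}.
Proof.
elim/last_ind: Z => // Z a IH symZ.
set New := catrev (flatten [seq C <- blocks Z | has (adj a) C]) [:: a].
have blocksE : blocks (rcons Z a) = New :: rev [seq C <- blocks Z | ~~ has (adj a) C].
  by rewrite /blocks foldl_rcons -/(blocks Z) absorbE.
have NewP : New \in blocks (rcons Z a) by rewrite blocksE mem_head.
have aNew : a \in New by rewrite /New catrevE mem_cat inE eqxx orbT.
have toNew D d : D \in blocks Z -> has (adj a) D -> d \in D -> d \in New.
  move=> DZ aD dD; rewrite /New catrevE mem_cat mem_rev; apply/orP; left.
  by apply/flattenP; exists D; rewrite // mem_filter aD.
have adjNew d : d \in Z -> adj a d -> d \in New.
  rewrite -(perm_mem (perm_flatten_blocks Z)) => /flattenP[D DZ dD] ad.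
  by apply: (toNew D); rewrite //; apply/hasP; exists d.
have inZ d : d \in rcons Z a -> d = a \/ d \in Z.
  by rewrite mem_rcons inE => /predU1P.
move=> b c bZa cZa; case: (inZ b bZa) => [-> | bZ]; case: (inZ c cZa) => [-> | cZ] bc.
- by exists New; rewrite ?aNew.
- by exists New; rewrite ?aNew ?adjNew.
- exists New => //; rewrite aNew adjNew // symZ //.
  by rewrite mem_rcons mem_head.
have [|C CZ /andP[bC cC]] := IH _ b c bZ cZ bc.
  by move=> x y xZ yZ; apply: symZ; rewrite mem_rcons inE ?xZ ?yZ orbT.
have [aC | aC] := boolP (has (adj a) C).
  by exists New; rewrite ?(toNew C).
by exists C; rewrite ?bC ?cC // blocksE inE mem_rev mem_filter aC CZ orbT.
Qed.

Lemma uniq_flatten_inj K C D b : uniq (flatten K) ->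
  C \in K -> D \in K -> b \in C -> b \in D -> C = D.
Proof.
elim: K => //= E K IH; rewrite cat_uniq => /and3P[_ /hasPn EK uK].
have out F : F \in K -> b \in E -> b \in F -> False.
  move=> FK bE bF; have /EK : b \in flatten K by apply/flattenP; exists F.
  by rewrite /= bE.
rewrite !inE => /predU1P[-> | CK] /predU1P[-> | DK] bC bD //.
- by case: (out D).
- by case: (out C).
- exact: IH.
Qed.

Lemma pmap_ohead_subseq K : subseq (pmap ohead K) (flatten K).
Proof.
elim: K => //= -[|c C] K IH //=; rewrite eqxx.
by apply: subseq_trans IH _; exact: suffix_subseq.
Qed.

Lemma representatives_subseq Z : subseq (representatives Z) (flatten (blocks Z)).
Proof. exact: pmap_ohead_subseq. Qed.

Lemma representatives_uniq Z : uniq Z -> uniq (representatives Z).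
Proof.
by rewrite -(perm_uniq (perm_flatten_blocks Z)); apply/subseq_uniq/representatives_subseq.
Qed.

Lemma representativesP Z r :
  reflect (exists2 C, C \in blocks Z & ohead C = Some r) (r \in representatives Z).
Proof. by rewrite mem_pmap; apply: (iffP mapP) => -[C CZ eqC]; exists C. Qed.

End Blocks.

(** [R] has exactly one element in each connected component of [Z]; stated with
    paths, so that no set of components has to be formed. *)
Definition picks_components (T : finType) (e : rel T) (Z R : {set T}) : Prop :=
  [/\ R \subset Z,
      {in Z, forall z, exists2 r, r \in R & connect e r z} &
      {in R &, forall r r', connect e r r' -> r = r'}].

Section Representatives.

Variables (T : finType) (adj : rel T) (Z : seq T).
Hypotheses (Zuniq : uniq Z) (adj_sym : {in Z &, symmetric adj}).

(** A path leaving a representative stays in its block, since each edge lies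
    within a single block and the blocks are disjoint. *)
Lemma representatives_pick_components :
  picks_components [rel b c | [&& b \in Z, c \in Z & adj b c]]
              [set z in Z] [set r in representatives adj Z].
Proof.
set e := [rel b c | _].
have e_sym : symmetric e.
  move=> b c; rewrite /=; case: (boolP (b \in Z)) => bZ; rewrite ?andbF //=.
  by case: (boolP (c \in Z)) => //= cZ; rewrite adj_sym.
have eqR : equivalence_rel (connect e).
  move=> x y z; split; first exact: connect0.
  by move/(same_connect (sym_connect_sym e_sym)) => ->.
have adjR : {in Z &, forall b c, adj b c -> connect e b c}.
  by move=> b c bZ cZ bc; apply: connect1; rewrite /= bZ cZ.
have blockR := block_rel eqR adjR.
have memZ z : (z \in Z) = (z \in flatten (blocks adj Z)).
  by rewrite (perm_mem (perm_flatten_blocks adj Z)).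
have head_in (C : seq T) r : ohead C = Some r -> r \in C.
  by case: C => //= c C [->]; exact: mem_head.
split.
- apply/subsetP=> r; rewrite !inE memZ; exact/mem_subseq/representatives_subseq.
- move=> z; rewrite inE memZ => /flattenP[C CZ zC].
  case Cr: (ohead C) => [r|]; last by case: C Cr zC {CZ}.
  exists r; first by rewrite inE; apply/representativesP; exists C.
  by apply: (blockR C) => //; exact: head_in.
move=> r r'; rewrite !inE => /representativesP[C CZ Cr] /representativesP[D DZ Dr'].
case/connectP=> p er r'p.
have : last r p \in C.
  elim: p r {Cr r'p} (head_in C r Cr) er => //= c p IH r rC /andP[/and3P[rZ cZ rc] pc].
  apply: IH => //; have [E EZ /andP[rE cE]] := adj_block adj_sym rZ cZ rc.
  rewrite (uniq_flatten_inj _ CZ EZ rC rE) //.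
  by rewrite (perm_uniq (perm_flatten_blocks adj Z)).
rewrite -r'p => r'C; apply: Some_inj; rewrite -Cr -Dr'.
rewrite (uniq_flatten_inj _ CZ DZ r'C (head_in D _ Dr')) //.
by rewrite (perm_uniq (perm_flatten_blocks adj Z)).
Qed.

End Representatives.

(** * The canonical basis of the order-convex sets *)

Section Convexity.

Variables (d : Order.disp_t) (P : finPOrderType d).
Implicit Types (x y z a b c : P) (X Y Z Q C : {set P}).

Definition interval x y : {set P} := [set z | (x < z < y)%O].

Lemma order_convexP Y :
  reflect {in Y &, forall x y, (x < y)%O -> interval x y \subset Y} (order_convex Y).
Proof.
apply: (iffP forall_inP) => [cvx x y xY yY _ | cvx x xY].
  apply/subsetP=> z; rewrite inE => /andP[/ltW xz /ltW zy].
  by have /forall_inP/(_ y yY)/forallP/(_ z)/implyP := cvx x xY; apply; rewrite xz.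
apply/forall_inP=> y yY; apply/forallP=> z; apply/implyP=> /andP[].
rewrite le_eqVlt => /predU1P[<- //|xz]; rewrite le_eqVlt => /predU1P[-> //|zy].
have /subsetP := cvx x y xY yY (lt_trans xz zy).
by apply; rewrite inE xz.
Qed.

Lemma Co_sub X : X \subset Co X.
Proof. by apply/bigcapsP=> Y /andP[]. Qed.

Lemma Co_min X Y : order_convex Y -> X \subset Y -> Co X \subset Y.
Proof. by move=> cvxY XY; apply: bigcap_inf; rewrite cvxY. Qed.

Lemma Co_convex X : order_convex (Co X).
Proof.
apply/order_convexP=> x y /bigcapP xX /bigcapP yX xy; apply/bigcapsP=> Y YX.
by have /andP[/order_convexP cvxY _] := YX; exact: cvxY (xX Y YX) (yX Y YX) xy.
Qed.

Lemma is_closed_Co Z : is_closed (@Co d P) Z = order_convex Z.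
Proof.
apply/eqP/idP=> [<- | cvxZ]; first exact: Co_convex.
by apply/eqP; rewrite eqEsubset Co_min ?Co_sub.
Qed.

Lemma mem_hull x y z :
  (z \in [set x; y] :|: interval x y) = [|| z == x, z == y | (x < z < y)%O].
Proof. by rewrite !inE orbA. Qed.

Lemma hull_bounds x y z : (x < y)%O ->
  z \in [set x; y] :|: interval x y -> (x <= z <= y)%O.
Proof.
move=> xy; rewrite mem_hull => /or3P[/eqP->|/eqP->|/andP[/ltW-> /ltW->]] //.
  by rewrite lexx ltW.
by rewrite lexx andbT ltW.
Qed.

Lemma hull_convex x y : (x < y)%O -> order_convex ([set x; y] :|: interval x y).
Proof.
move=> xy.
apply/order_convexP=> a b /(hull_bounds xy)/andP[xa _] /(hull_bounds xy)/andP[_ bY] _.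
apply/subsetP=> z; rewrite inE mem_hull => /andP[az zb].
by rewrite (le_lt_trans xa az) (lt_le_trans zb bY) !orbT.
Qed.

Lemma Co_between x y X : (x < y)%O ->
  [set x; y] \subset X -> X \subset [set x; y] :|: interval x y ->
  Co X = [set x; y] :|: interval x y.
Proof.
move=> xy xyX Xxy; apply/eqP; rewrite eqEsubset Co_min ?hull_convex //=.
have xyC := subset_trans xyX (Co_sub X); rewrite subUset xyC /=.
move: xyC; rewrite subUset !sub1set => /andP[xC yC].
exact: (order_convexP _ (Co_convex X)).
Qed.

Lemma sub_pair_convex x y Q : ~~ ([set x; y] \subset Q) -> Q \subset [set x; y] ->
  order_convex Q.
Proof.
move=> nQ /subsetP Qxy; apply/order_convexP=> a b aQ bQ ab; case/negP: nQ.
have: a != b by rewrite lt_eqF.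
move: (Qxy a aQ) (Qxy b bQ); rewrite !inE subUset !sub1set.
by case/pred2P=> ea; case/pred2P=> eb; move: aQ bQ; rewrite ea eb ?eqxx // => -> ->.
Qed.

Lemma interval_disjoint x y : [disjoint [set x; y] & interval x y].
Proof.
rewrite disjoint_subset; apply/subsetP=> z.
by rewrite !inE => /pred2P[] ->; rewrite ltxx ?andbF.
Qed.

Lemma pair_not_convex x y : (x < y)%O -> interval x y != set0 ->
  ~~ order_convex [set x; y].
Proof.
move=> xy /set0Pn[z zI]; apply/order_convexP=> /(_ x y).
rewrite !inE !eqxx orbT => /(_ isT isT xy)/subsetP/(_ z zI) zxy.
by have /pred0P/(_ z) := interval_disjoint x y; rewrite /= zxy zI.
Qed.

Lemma quasi_closed_pair x y : (x < y)%O -> interval x y != set0 ->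
  quasi_closed (@Co d P) [set x; y].
Proof.
move=> xy I0; rewrite /quasi_closed is_closed_Co pair_not_convex //=.
apply/forallP=> X; rewrite !is_closed_Co; apply/implyP=> _; apply/implyP=> nX.
apply: (@sub_pair_convex x y); last exact: subsetIl.
by rewrite subsetI subxx.
Qed.

(** If [Q] is not convex, some [x < y] in [Q] have an element of [(x, y)] outside
    [Q].  Were [Q] not included in [[x, y]], its trace on that convex set would
    be convex and contain [(x, y)]. *)
Lemma quasi_closed_sandwich Q : quasi_closed (@Co d P) Q ->
  exists x y, [/\ (x < y)%O, interval x y != set0, [set x; y] \subset Q &
                  Q \subset [set x; y] :|: interval x y].
Proof.
rewrite /quasi_closed is_closed_Co => /andP[ncvx /forallP qc].
have [x xQ [y yQ [xy nI]]] : exists2 x, x \in Q & exists2 y, y \in Q &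
    (x < y)%O /\ ~~ (interval x y \subset Q).
  have : ~~ [forall x in Q, forall y in Q, (x < y)%O ==> (interval x y \subset Q)].
    apply: contra ncvx => /forall_inP H; apply/order_convexP=> x y xQ yQ.
    by have /forall_inP/(_ y yQ)/implyP := H x xQ.
  rewrite negb_forall_in => /exists_inP[x xQ]; rewrite negb_forall_in.
  by case/exists_inP=> y yQ; rewrite negb_imply => /andP[]; exists x => //; exists y.
exists x, y; split=> //.
- by apply: contraNneq nI => ->; exact: sub0set.
- by rewrite subUset !sub1set xQ.
apply: contraNT nI => nQ.
move: (qc ([set x; y] :|: interval x y)); rewrite !is_closed_Co hull_convex // nQ /=.
move/order_convexP/(_ x y); rewrite !in_setI !mem_hull xQ yQ !eqxx orbT.
by move/(_ isT isT xy)/subset_trans; apply; exact: subsetIl.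
Qed.

(** A quasi-closed set lies between [{x, y}] and [[x, y]] for some pair, so it
    generates the same convex set as the quasi-closed set [{x, y}]; a critical
    one is thus equal to that pair. *)
Lemma canonical_basisP k :
  reflect (exists x y, [/\ (x < y)%O, interval x y != set0 &
                           k = ([set x; y], interval x y)])
          (k \in canonical_basis (@Co d P)).
Proof.
have pairE x y : (x < y)%O -> Co [set x; y] :\: [set x; y] = interval x y.
  move=> xy; rewrite (Co_between xy) ?subsetUl // setDUl setDv set0U.
  by apply/setDidPl; rewrite disjoint_sym interval_disjoint.
apply: (iffP imsetP) => [[C] | [x [y [xy I0 ->]]]].
  rewrite inE => /andP[qC /forallP critC] ->.
  have [x [y [xy I0 xyC Cxy]]] := quasi_closed_sandwich qC.
  have CE : [set x; y] = C.
    apply/eqP; move: (critC [set x; y]); rewrite xyC quasi_closed_pair //=.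
    by rewrite (Co_between xy xyC Cxy) (Co_between xy) ?subsetUl // eqxx.
  by exists x, y; rewrite -CE pairE.
exists [set x; y]; last by rewrite pairE.
rewrite inE /critical quasi_closed_pair //=; apply/forallP=> Q.
apply/implyP=> /and3P[Qxy qQ _]; rewrite eqEsubset Qxy /=.
by apply: contraTT qQ => nQ; rewrite /quasi_closed is_closed_Co (sub_pair_convex nQ Qxy).
Qed.

Definition comparability (I : {set P}) : rel P :=
  [rel b c | [&& b \in I, c \in I & (b < c)%O || (c < b)%O]].

Lemma comparability_connect_sym I : connect_sym (comparability I).
Proof.
by apply: sym_connect_sym => b c; rewrite /comparability /= orbC andbCA.
Qed.

(** * Optimum bases *)

Section Optimum.

Variable R : {set P} * {set P} -> {set P}.

Hypothesis R_picks : forall x y, (x < y)%O -> interval x y != set0 ->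
  picks_components (comparability (interval x y)) (interval x y)
              (R ([set x; y], interval x y)).

Let shrunk : {set {set P} * {set P}} :=
  [set (k.1, R k) | k in canonical_basis (@Co d P)].

Lemma shrunk_basisP i :
  reflect (exists x y, [/\ (x < y)%O, interval x y != set0 &
                        i = ([set x; y], R ([set x; y], interval x y))])
          (i \in shrunk).
Proof.
apply: (iffP imsetP) => [[k /canonical_basisP[x [y [xy I0 ->]]] ->] |].
  by exists x, y.
move=> [x [y [xy I0 ->]]]; exists ([set x; y], interval x y) => //.
by apply/canonical_basisP; exists x, y.
Qed.

(** Strong induction on the size of the interval, walking along a path from a
    representative: if [b] has been reached, its neighbour [c] is in [(b, y)] or
    in [(x, b)], and both intervals miss [b]. *)
Lemma respects_interval Z x y : respects shrunk Z ->
  x \in Z -> y \in Z -> (x < y)%O -> interval x y \subset Z.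
Proof.
move=> /forall_inP respZ; have [n] := ubnP #|interval x y|.
elim: n x y => // n IH x y; rewrite ltnS => In xZ yZ xy.
have [-> | I0] := eqVneq (interval x y) set0; first exact: sub0set.
have [RI cover _] := R_picks xy I0.
have RZ : R ([set x; y], interval x y) \subset Z.
  have kS : ([set x; y], R ([set x; y], interval x y)) \in shrunk.
    by apply/shrunk_basisP; exists x, y.
  by have /implyP := respZ _ kS; rewrite subUset !sub1set xZ yZ; apply.
have smaller u v w : w \in interval x y -> w \notin interval u v ->
    interval u v \subset interval x y -> (u < v)%O -> u \in Z -> v \in Z ->
    interval u v \subset Z.
  move=> wI nw sub uv uZ vZ; apply: IH => //; apply: leq_trans In.
  by apply/proper_card/properP; split=> //; exists w.
apply/subsetP=> z /cover[r /(subsetP RZ) rZ /connectP[p]].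
elim: p r rZ => [|c p IHp] b bZ /=; first by move=> _ ->.
case/andP=> /and3P[bI cI bc] cp zE; apply: (IHp c) cp zE.
move: (bI) (cI); rewrite !inE => /andP[xb by_] /andP[xc cy].
case/orP: bc => bc.
  have /subsetP : interval b y \subset Z.
    apply: (smaller b y b) => //; first by rewrite inE ltxx.
    by apply/subsetP=> w; rewrite !inE => /andP[/(lt_trans xb) -> ->].
  by apply; rewrite inE bc.
have /subsetP : interval x b \subset Z.
  apply: (smaller x b b) => //; first by rewrite inE ltxx andbF.
  by apply/subsetP=> w; rewrite !inE => /andP[-> /lt_trans->].
by apply; rewrite inE xc.
Qed.

Lemma shrunk_is_basis : is_basis (@Co d P) shrunk.
Proof.
split=> [i /shrunk_basisP[x [y [xy I0 ->]]] | Z].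
  have [RI cover _] := R_picks xy I0; apply/and3P; split=> /=.
  - by apply/set0Pn; exists x; rewrite set21.
  - by have /set0Pn[z /cover[r rR _]] := I0; apply/set0Pn; exists r.
  - exact: disjointWr RI (interval_disjoint x y).
rewrite is_closed_Co; apply/order_convexP/idP=> [cvx | respZ x y xZ yZ]; last first.
  exact: respects_interval.
apply/forall_inP=> i /shrunk_basisP[x [y [xy I0 ->]]]; apply/implyP=> /=.
rewrite subUset !sub1set => /andP[xZ yZ].
have [RI _ _] := R_picks xy I0.
exact: subset_trans RI (cvx x y xZ yZ xy).
Qed.

Lemma shrunk_basis_size :
  basis_size shrunk = \sum_(k in canonical_basis (@Co d P)) (#|k.1| + #|R k|).
Proof.
rewrite /basis_size /shrunk big_imset //= => _ _ /imsetP[C _ ->] /imsetP[D _ ->].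
by move=> [CD _]; rewrite CD.
Qed.

(** [within k] selects the implications whose left side generates the same
    convex set as that of [k]; in an arbitrary basis, they do the work of [k]. *)
Definition within (k i : {set P} * {set P}) : bool :=
  (k.1 \subset i.1) && (i.1 \subset k.1 :|: k.2).

Lemma within_inj i : {in canonical_basis (@Co d P) &, forall k k',
  within k i -> within k' i -> k = k'}.
Proof.
have bounds x y u v : (u < v)%O -> within ([set x; y], interval x y) i ->
    within ([set u; v], interval u v) i -> (u <= x)%O && (y <= v)%O.
  move=> uv /andP[/= xyi _] /andP[/= _ /subsetP iuv].
  move: xyi; rewrite subUset !sub1set => /andP[/iuv xi /iuv yi].
  by have /andP[-> _] := hull_bounds uv xi; have /andP[_ ->] := hull_bounds uv yi.
move=> _ _ /canonical_basisP[x [y [xy _ ->]]] /canonical_basisP[u [v [uv _ ->]]] xyi uvi.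
have /andP[ux yv] := bounds x y u v uv xyi uvi.
have /andP[xu vy] := bounds u v x y xy uvi xyi.
have -> : x = u by apply/le_anti; rewrite xu.
by have -> : y = v by apply/le_anti; rewrite yv.
Qed.

(** [{x, y}] is not convex but its proper subsets are, so only an implication with
    premise exactly [{x, y}] can apply to it. *)
Lemma basis_contains_pair Sigma' x y : is_basis (@Co d P) Sigma' ->
  (x < y)%O -> interval x y != set0 ->
  exists2 i, i \in Sigma' & i.1 = [set x; y].
Proof.
move=> [_ closedE] xy I0; have := pair_not_convex xy I0.
rewrite -is_closed_Co closedE negb_forall_in => /exists_inP[i iS'].
rewrite negb_imply => /andP[i1 i2]; exists i => //.
apply/eqP; rewrite eqEsubset i1; apply: contraNT i2 => n1.
have := sub_pair_convex n1 i1; rewrite -is_closed_Co closedE => /forall_inP/(_ i iS').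
by rewrite subxx => /subset_trans; apply.
Qed.

(** [[x, y]] without the component [K] of [r] is not convex, so some implication
    leads from it into [K].  Its premise contains [x], because removing [x] as
    well leaves a convex set: an element below an element of [K] would then lie
    in [(x, y)], be comparable to it, and so belong to [K].  Dually for [y]. *)
Lemma basis_meets_component Sigma' x y r : is_basis (@Co d P) Sigma' ->
  (x < y)%O -> r \in interval x y ->
  exists i z, [/\ i \in Sigma', within ([set x; y], interval x y) i,
                  z \in i.2 & connect (comparability (interval x y)) r z].
Proof.
move=> [_ closedE] xy rI; set e := comparability _.
pose K := [set z in interval x y | connect e r z].
set hull := [set x; y] :|: interval x y.
have rK : r \in K by rewrite inE rI connect0.
have KI : {subset K <= interval x y} by move=> z; rewrite inE => /andP[].
have saturated b c : b \in K -> c \in interval x y -> (b < c)%O || (c < b)%O -> c \in K.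
  rewrite [b \in K]in_set [c \in K]in_set => /andP[bI rb] cI bc; rewrite cI /=.
  by apply: connect_trans rb (connect1 _); rewrite /e /comparability /= bI cI.
have pairK z : z \in [set x; y] -> z \notin K.
  move=> zxy; apply/negP=> /KI zI.
  by have /pred0P/(_ z) := interval_disjoint x y; rewrite /= zxy zI.
have xD : x \in hull :\: K by rewrite inE pairK ?inE ?eqxx.
have yD : y \in hull :\: K by rewrite inE pairK ?inE ?eqxx ?orbT.
have : ~~ respects Sigma' (hull :\: K).
  rewrite -closedE is_closed_Co; apply/order_convexP=> /(_ x y xD yD xy)/subsetP/(_ r rI).
  by rewrite inE rK.
rewrite negb_forall_in => /exists_inP[i iS'].
rewrite negb_imply => /andP[i1 /subsetPn[z zi zD]].
have i1hull : i.1 \subset hull := subset_trans i1 (subsetDl _ _).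
have zhull : z \in hull.
  have := hull_convex xy; rewrite -is_closed_Co closedE => /forall_inP/(_ i iS').
  by rewrite i1hull => /subsetP/(_ z zi).
have zK : z \in K by move: zD; rewrite in_setD zhull andbT negbK.
have endpoint w : w \in [set x; y] -> w \in i.1.
  move=> wxy; apply: contraTT (zi) => wi.
  have cvx : order_convex ((hull :\: K) :\ w).
    apply/order_convexP=> a b; rewrite !in_setD1 !in_setD.
    move=> /and3P[aw aK ah] /and3P[bw bK bh] ab; apply/subsetP=> c cab.
    have : c \in hull.
      have /order_convexP/(_ a b ah bh ab)/subsetP := hull_convex xy; exact.
    rewrite in_setD1 in_setD => ch; rewrite ch andbT.
    move: cab; rewrite inE => /andP[ac cb].
    have /andP[xa _] := hull_bounds xy ah; have /andP[_ by_] := hull_bounds xy bh.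
    have xc := le_lt_trans xa ac; have cy := lt_le_trans cb by_.
    apply/andP; split.
      by case/set2P: wxy => ->; rewrite ?(gt_eqF xc) ?(lt_eqF cy).
    case/set2P: wxy => ew; rewrite {}ew in aw bw.
      apply: contra aK => cK; apply: (saturated c) => //; last by rewrite ac orbT.
      by rewrite inE lt_neqAle eq_sym aw xa (lt_trans ac).
    apply: contra bK => cK; apply: (saturated c) => //; last by rewrite cb.
    by rewrite inE (lt_trans xc) //= lt_neqAle bw.
  have : i.1 \subset (hull :\: K) :\ w by rewrite subsetD1 i1.
  move: cvx; rewrite -is_closed_Co closedE => /forall_inP/(_ i iS')/implyP H /H.
  by move/subsetP=> sub; apply/negP=> /sub; rewrite in_setD1 in_setD zK andbF.
exists i, z; split=> //; last by move: zK; rewrite inE => /andP[].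
rewrite /within i1hull andbT; apply/subsetP; exact: endpoint.
Qed.

(** The representatives lie in different components, and each component is met
    by some conclusion.  Hence the representatives can be mapped injectively to
    the union of the conclusions. *)
Lemma basis_weight_lower_bound Sigma' k : is_basis (@Co d P) Sigma' ->
  k \in canonical_basis (@Co d P) ->
  #|k.1| + #|R k| <= \sum_(i in Sigma' | within k i) (#|i.1| + #|i.2|).
Proof.
move=> basis' /canonical_basisP[x [y [xy I0 ->]]].
set k0 := ([set x; y], interval x y); rewrite big_split /=.
have [RI cover indep] := R_picks xy I0.
set e := comparability _ in cover indep; apply: leq_add.
  have [i iS' i1] := basis_contains_pair basis' xy I0.
  by rewrite (bigD1 i) /= ?i1 ?leq_addr // iS' /within i1 subxx subsetUl.
pose V := \bigcup_(i in Sigma' | within k0 i) i.2.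
apply: (@leq_trans #|V|); last first.
  rewrite /V; elim/big_rec2: _ => [|i n W _ Wn]; first by rewrite cards0.
  by apply: leq_trans (leq_card_setU _ _) _; rewrite leq_add2l.
pose hit r := odflt r [pick z in V | connect e r z].
have hitP r : r \in R k0 -> hit r \in V /\ connect e r (hit r).
  move=> rR; rewrite /hit; case: pickP => [z /andP[] // | none].
  have [i [z [iS' ki zi rz]]] := basis_meets_component basis' xy (subsetP RI r rR).
  have /negP[] := negbT (none z); rewrite rz andbT.
  by apply/bigcupP; exists i; rewrite ?iS'.
have hit_inj : {in R k0 &, injective hit}.
  move=> r r' rR r'R hitE; apply: indep => //.
  have [_ rz] := hitP r rR; have [_ r'z] := hitP r' r'R.
  apply: connect_trans rz _.
  by rewrite hitE comparability_connect_sym.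
rewrite -[#|R _|](card_in_imset hit_inj).
by apply/subset_leq_card/subsetP=> _ /imsetP[r /hitP[rV _] ->].
Qed.

Lemma shrunk_basis_optimum : is_optimum_basis (@Co d P) shrunk.
Proof.
split=> [|Sigma' basis']; first exact: shrunk_is_basis.
rewrite shrunk_basis_size.
apply: leq_trans (_ : \sum_(k in canonical_basis (@Co d P))
  \sum_(i in Sigma' | within k i) (#|i.1| + #|i.2|) <= _).
  by apply: leq_sum => k kC; exact: basis_weight_lower_bound.
rewrite (exchange_big_dep (mem Sigma')) /=; last by move=> k i _ /andP[].
apply: leq_sum => i _; rewrite sum_nat_const.
rewrite -[leqRHS]mul1n leq_mul2r; apply/orP; right.
apply/card_le1_eqP=> k k'.
move=> /andP[kC /andP[_ ki]] /andP[kC' /andP[_ ki']].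
exact: within_inj kC' kC ki' ki.
Qed.

End Optimum.

End Convexity.

(** * The program *)

(** A register named in the plural holds what remains of the list that a loop
    traverses; loops may share registers only if neither contains the other. *)
Module Var.
Definition sigma := 0.   Definition out := 1.
Definition imp := 2.     Definition imps := 3.
Definition K := 4.       Definition a := 5.     Definition aS := 6.
Definition M := 7.       Definition C := 8.     Definition Cs := 9.
Definition flag := 10.   Definition c := 11.    Definition cs := 12.
Definition i := 13.      Definition is_ := 14.
Definition u := 15.      Definition us := 16.
Definition w := 17.      Definition ws := 18.
Definition Y := 19.
End Var.

Definition skip x : cmd := CAssign x (EVar x).

Definition test_conclusion : cmd :=
  CIf (ESameAtom (EVar Var.w) (EVar Var.c))
      (CAssign Var.flag (ECons ENil ENil)) (skip Var.flag).

Definition test_premise : cmd :=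
  CIf (ESameAtom (EVar Var.u) (EVar Var.a))
      (foreach Var.w Var.ws (ETl (EVar Var.i)) test_conclusion) (skip Var.flag).

Definition test_implication : cmd :=
  foreach Var.u Var.us (EHd (EVar Var.i)) test_premise.

Definition test_element : cmd :=
  foreach Var.i Var.is_ (EVar Var.sigma) test_implication.

Definition test_block : cmd :=
  CSeq (CAssign Var.flag ENil) (foreach Var.c Var.cs (EVar Var.C) test_element).

Definition push_block : cmd :=
  foreach Var.c Var.cs (EVar Var.C)
    (CAssign Var.M (ECons (ECons (EVar Var.c) (EHd (EVar Var.M))) (ETl (EVar Var.M)))).

Definition merge_block : cmd :=
  CSeq test_block
    (CIf (EVar Var.flag) push_block
       (CAssign Var.M (ECons (EHd (EVar Var.M))
                             (ECons (EVar Var.C) (ETl (EVar Var.M)))))).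

Definition absorb_element : cmd :=
  CSeq (CAssign Var.M (ECons (ECons (EVar Var.a) ENil) ENil))
    (CSeq (foreach Var.C Var.Cs (EVar Var.K) merge_block)
          (CAssign Var.K (EVar Var.M))).

Definition compute_blocks : cmd :=
  CSeq (CAssign Var.K ENil)
       (foreach Var.a Var.aS (ETl (EVar Var.imp)) absorb_element).

Definition compute_representatives : cmd :=
  CSeq (CAssign Var.Y ENil)
    (foreach Var.C Var.Cs (EVar Var.K)
       (CIf (EVar Var.C)
            (CAssign Var.Y (ECons (EHd (EVar Var.C)) (EVar Var.Y))) (skip Var.Y))).

Definition shrink_implication : cmd :=
  CSeq compute_blocks
    (CSeq compute_representatives
       (CAssign Var.out
          (ECons (ECons (EHd (EVar Var.imp)) (EVar Var.Y)) (EVar Var.out)))).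

Definition optimum_program : cmd :=
  CSeq (foreach Var.imp Var.imps (EVar Var.sigma) shrink_implication)
       (CAssign Var.sigma (EVar Var.out)).

(** Time bounds for lists of length at most [N]; the constants are the costs of
    the assignments and tests in the commands above. *)
Definition test_block_time N : nat :=
  (2 + loop_time 1 N
         (loop_time 1 N (loop_time 2 N (3 + loop_time 2 N 8).+1))).+1.

Definition merge_block_time N : nat :=
  (test_block_time N + (1 + (loop_time 1 N 8 + 8)).+1).+1.

Definition absorb_element_time N : nat :=
  (6 + (loop_time 1 N (merge_block_time N) + 2).+1).+1.

Definition compute_blocks_time N : nat :=
  (2 + loop_time 2 N (absorb_element_time N)).+1.

Definition compute_representatives_time N : nat :=
  (2 + loop_time 1 N 7).+1.

Definition shrink_implication_time N : nat :=
  (compute_blocks_time N + (compute_representatives_time N + 7).+1).+1.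

Definition optimum_program_time N : nat :=
  (loop_time 1 N (shrink_implication_time N) + 2).+1.

Lemma loop_time_poly et (f : nat -> nat) :
  (exists p : {poly nat}, forall n, (p.[n])%R = f n) ->
  exists p : {poly nat}, forall n, (p.[n])%R = loop_time et n (f n).
Proof.
move=> [p pf]; exists ('X * (p + (10%N)%:P) + (et + 4)%:P)%R => n.
by rewrite hornerD hornerM hornerX hornerD !hornerC pf /loop_time -addnA.
Qed.

Lemma addn_poly (f g : nat -> nat) :
  (exists p : {poly nat}, forall n, (p.[n])%R = f n) ->
  (exists p : {poly nat}, forall n, (p.[n])%R = g n) ->
  exists p : {poly nat}, forall n, (p.[n])%R = f n + g n.
Proof.
by move=> [p pf] [q qg]; exists (p + q)%R => n; rewrite hornerD pf qg.
Qed.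

Lemma const_poly k : exists p : {poly nat}, forall n, (p.[n])%R = k.
Proof. by exists (k%:P)%R => n; rewrite hornerC. Qed.

Lemma succn_poly (f : nat -> nat) :
  (exists p : {poly nat}, forall n, (p.[n])%R = f n) ->
  exists p : {poly nat}, forall n, (p.[n])%R = (f n).+1.
Proof. by move=> /(addn_poly (const_poly 1))[p pE]; exists p. Qed.

Lemma optimum_program_time_poly :
  exists p : {poly nat}, forall n, (p.[n])%R = optimum_program_time n.
Proof.
rewrite /optimum_program_time /shrink_implication_time /compute_blocks_time.
rewrite /compute_representatives_time /absorb_element_time /merge_block_time.
rewrite /test_block_time.
by repeat first [exact: const_poly | apply: loop_time_poly
                | apply: succn_poly | apply: addn_poly].
Qed.

Section Program.

Variable A : eqType.
Implicit Types (s : store A) (a c : A) (C Z : seq A) (K : seq (seq A)).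
Implicit Types (i : seq A * seq A) (l : seq (seq A * seq A)).

Definition enc_elements C : tree A := tree_of_seq (map (@Atom A) C).
Definition enc_blocks K : tree A := tree_of_seq (map enc_elements K).
Definition enc_imp i : tree A := Cons (enc_elements i.1) (enc_elements i.2).
Definition enc_bool (b : bool) : tree A := if b then Cons Nil Nil else Nil.

(** The comparability of two elements of one interval, as it is visible in the
    listed implications. *)
Definition linked l : rel A :=
  [rel a c | has (fun i => (a \in i.1) && (c \in i.2)) l].

Definition bounded N l : Prop :=
  size l <= N /\ {in l, forall i, size i.1 <= N /\ size i.2 <= N}.

(** Loops that only ever raise a flag compute [has]. *)
Lemma runs_search (X : eqType) (encX : X -> tree A) (p : pred X) (x l r : nat)
    (e : expr) (c : cmd) s (xs : seq X) b N T :
  [&& x != l, r != l, r != x & l \notin writes c] ->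
  eval s e = tree_of_seq (map encX xs) -> size xs <= N -> s r = enc_bool b ->
  (forall y b0 s0, y \in xs ->
     agree_off (r :: writes (foreach x l e c)) s s0 ->
     s0 x = encX y -> s0 r = enc_bool b0 ->
     runs c s0 T (fun s1 => s1 r = enc_bool (b0 || p y))) ->
  runs (foreach x l e c) s (loop_time (expr_time e) N T)
       (fun s' => s' r = enc_bool (b || has p xs)).
Proof.
move=> vars es szN sr body.
have orE : b || has p xs = foldl (fun b0 y => b0 || p y) b xs.
  by elim: xs b {es szN sr body} => [|y xs IH] b /=; rewrite ?orbF // -IH orbA.
rewrite orE; apply: (runs_foreach (encX := encX) (encS := enc_bool)) => //.
move=> pre y post s0 exs fr s0x s0r.
by apply: body => //; rewrite exs mem_cat mem_head orbT.
Qed.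

Lemma has_eq_mem a C : has (fun c => c == a) C = (a \in C).
Proof. by rewrite -has_pred1. Qed.

Lemma runs_test_block N l a C s : bounded N l -> size C <= N ->
  s Var.sigma = tree_of_implications l -> s Var.a = Atom a ->
  s Var.C = enc_elements C ->
  runs test_block s (test_block_time N)
       (fun s' => s' Var.flag = enc_bool (has (linked l a) C)).
Proof.
move=> [szl szi] szC sS sa sC; apply: runs_seq.
  by apply: (runs_assign (Q := fun s1 => s1 Var.flag = enc_bool false)).
move=> s1 fr1 s1f; rewrite -[has _ _]orFb.
apply: runs_search => //; first by rewrite /= fr1 // sC.
move=> c b2 s2 cC fr2 s2c s2f; rewrite /linked /=.
apply: (runs_search (encX := enc_imp)) => //.
  by rewrite /= fr2 // fr1 // sS.
move=> i b3 s3 il fr3 s3i s3f; have [sz1 sz2] := szi i il.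
rewrite -(has_eq_mem a) -(has_eq_mem c).
have -> : has (fun u => u == a) i.1 && has (fun w => w == c) i.2 =
          has (fun u => (u == a) && has (fun w => w == c) i.2) i.1.
  by elim: i.1 => //= u us <-; rewrite andb_orl.
apply: runs_search => //; first by rewrite /= s3i.
move=> u b4 s4 ui fr4 s4u s4f; apply: runs_if.
have s4a : s4 Var.a = Atom a by rewrite fr4 // fr3 // fr2 // fr1.
rewrite /= s4u s4a; case: (u == a) => /=; last first.
  by apply: runs_assign; [rewrite /loop_time /=; lia | rewrite /update /= orbF].
apply: runs_search => //; first by rewrite /= fr4 // s3i.
move=> w b5 s5 wi fr5 s5w s5f; apply: (runs_if (T := 4)).
have s5c : s5 Var.c = Atom c by rewrite fr5 // fr4 // fr3 // s2c.
rewrite /= s5w s5c; case: (w == c) => /=; apply: runs_assign => //.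
  by rewrite /update /= orbT.
by rewrite /update /= orbF.
Qed.

Lemma enc_head K : (if enc_blocks K is Cons t _ then t else Nil) = enc_elements (head [::] K).
Proof. by case: K. Qed.

Lemma enc_behead K : (if enc_blocks K is Cons _ t then t else Nil) = enc_blocks (behead K).
Proof. by case: K. Qed.

Lemma runs_merge_block N l a C M s : bounded N l -> size C <= N ->
  s Var.sigma = tree_of_implications l -> s Var.a = Atom a ->
  s Var.C = enc_elements C -> s Var.M = enc_blocks M ->
  runs merge_block s (merge_block_time N)
       (fun s' => s' Var.M = enc_blocks (merge (linked l) a M C)).
Proof.
move=> bl szC sS sa sC sM; apply: runs_seq; first exact: (runs_test_block bl szC sS sa sC).
move=> s1 fr1 s1f; apply: runs_if; rewrite /merge.
have s1C : s1 Var.C = enc_elements C by rewrite fr1.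
have s1M : s1 Var.M = enc_blocks M by rewrite fr1.
rewrite /= s1f; case: (has _ C) => /=; last first.
  apply: runs_assign; first exact: leq_addl.
  by rewrite /update /= s1M s1C enc_head enc_behead.
apply: (@runs_weaken _ _ _ (loop_time 1 N 8)); last 1 first.
- by move=> s' _; exact: id.
- apply: (runs_foreach (encX := @Atom A) (encS := enc_blocks) (f := @push A)) => //=.
  move=> pre c post s2 _ fr2 s2c s2M.
  by apply: runs_assign; rewrite // /update /= s2M s2c enc_head enc_behead.
- exact: leq_addr.
Qed.

Lemma runs_absorb_element N l a K s : bounded N l ->
  size K <= N -> {in K, forall C, size C <= N} ->
  s Var.sigma = tree_of_implications l -> s Var.a = Atom a ->
  s Var.K = enc_blocks K ->
  runs absorb_element s (absorb_element_time N)
       (fun s' => s' Var.K = enc_blocks (absorb (linked l) K a)).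
Proof.
move=> bl szK szC sS sa sK; apply: runs_seq.
  apply: (runs_assign (Q := fun s1 => s1 Var.M = enc_blocks [:: [:: a]])) => //.
  by rewrite /update /= sa.
move=> s1 fr1 s1M; apply: runs_seq.
  apply: (runs_foreach (r := Var.M) (encX := enc_elements) (encS := enc_blocks)
           (f := merge (linked l) a) (acc := [:: [:: a]]) (xs := K)) => //.
    by rewrite /= fr1.
  move=> pre C post s2 eK fr2 s2C s2M; apply: runs_merge_block => //.
  - by apply: szC; rewrite eK mem_cat mem_head orbT.
  - by rewrite fr2 // fr1.
  - by rewrite fr2 // fr1.
by move=> s2 fr2 s2M; apply: runs_assign; rewrite // /update /= s2M.
Qed.

Lemma runs_compute_blocks N l i s : bounded N l -> i \in l ->
  s Var.sigma = tree_of_implications l -> s Var.imp = enc_imp i ->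
  runs compute_blocks s (compute_blocks_time N)
       (fun s' => s' Var.K = enc_blocks (blocks (linked l) i.2)).
Proof.
move=> bl il sS si; have [_ /(_ i il)[_ szi]] := bl; apply: runs_seq.
  by apply: (runs_assign (Q := fun s1 => s1 Var.K = enc_blocks [::])).
move=> s1 fr1 s1K.
apply: (runs_foreach (encX := @Atom A) (encS := enc_blocks)) => //.
  by rewrite /= fr1 // si.
move=> pre a post s2 ei fr2 s2a s2K.
have szpre : size pre <= N.
  by apply: leq_trans szi; rewrite ei size_cat leq_addr.
apply: runs_absorb_element => //.
- exact: leq_trans (size_blocks _ _) szpre.
- by move=> C CK; exact: leq_trans (size_block CK) szpre.
- by rewrite fr2 // fr1.
Qed.

Lemma runs_compute_representatives N K s : size K <= N ->
  s Var.K = enc_blocks K ->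
  runs compute_representatives s (compute_representatives_time N)
       (fun s' => s' Var.Y = enc_elements (rev (pmap ohead K))).
Proof.
move=> szK sK; apply: runs_seq.
  by apply: (runs_assign (Q := fun s1 => s1 Var.Y = enc_elements [::])).
move=> s1 fr1 s1Y.
pose add Y C := if ohead C is Some c then c :: Y else Y : seq A.
have revE : rev (pmap ohead K) = foldl add [::] K.
  rewrite -[LHS]cats0; elim: K [::] {szK sK} => [|[|c C] K IH] Y //=.
  by rewrite rev_cons cat_rcons IH.
rewrite revE.
apply: (runs_foreach (encX := enc_elements) (encS := enc_elements)) => //.
  by rewrite /= fr1.
move=> pre C post s2 eK fr2 s2C s2Y; apply: (runs_if (T := 5)).
rewrite /= s2C; case: C {eK} s2C => [|c C] s2C /=; apply: runs_assign => //.
by rewrite /update /= s2C s2Y.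
Qed.

Lemma runs_optimum_program N l : bounded N l ->
  runs optimum_program (init_store (tree_of_implications l)) (optimum_program_time N)
    (fun s' => output s' =
       tree_of_implications
         (rev [seq (i.1, rev (representatives (linked l) i.2)) | i <- l])).
Proof.
move=> bl; have [szl szi] := bl.
pose add out i := (i.1, rev (representatives (linked l) i.2)) :: out.
have revE l' out :
    rev [seq (i.1, rev (representatives (linked l) i.2)) | i <- l'] ++ out =
    foldl add out l'.
  by elim: l' out => //= i l' IH out; rewrite rev_cons cat_rcons IH.
rewrite -[rev _]cats0 {}revE; apply: runs_seq.
  apply: (runs_foreach (r := Var.out) (encX := enc_imp) (encS := @tree_of_implications A)
            (f := add) (acc := [::]) (xs := l) (N := N) (T := shrink_implication_time N)) => //.
  move=> pre i post s1 el fr1 s1i s1out.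
  have il : i \in l by rewrite el mem_cat mem_head orbT.
  have [_ szi2] := szi i il.
  apply: runs_seq; first by apply: (runs_compute_blocks bl il) => //; rewrite fr1.
  move=> s2 fr2 s2K; apply: runs_seq.
    apply: (runs_compute_representatives (N := N)) s2K.
    exact: leq_trans (size_blocks _ _) szi2.
  move=> s3 fr3 s3Y; apply: runs_assign => //.
  rewrite /update /= s3Y fr3 // fr2 // s1i.
  by rewrite fr3 // fr2 // s1out.
by move=> s1 _ s1out; apply: runs_assign; rewrite // /output /update /= s1out.
Qed.

End Program.

(** * Correctness on a listing of the canonical basis *)

Section Listing.

Variables (T : finType) (l : seq (seq T * seq T)).
Hypothesis l_uniq : all (fun i => uniq i.1 && uniq i.2) l.
Hypothesis imp_uniq : uniq (map (@implication_of_seqs T) l).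

Let Sigma : {set {set T} * {set T}} := [set k in map (@implication_of_seqs T) l].

Lemma basis_size_listing : basis_size Sigma = \sum_(i <- l) (size i.1 + size i.2).
Proof.
rewrite /basis_size (eq_bigl _ _ (in_set (mem (map (@implication_of_seqs T) l)))).
rewrite -big_uniq //= big_map big_seq [RHS]big_seq; apply: eq_bigr => i il.
have /andP[u1 u2] := allP l_uniq i il.
by rewrite !cardsE (card_uniqP u1) (card_uniqP u2).
Qed.

(** All lists traversed by the program are bounded by the size of the basis; the
    number of implications is, because each has a nonempty premise. *)
Lemma bounded_listing : {in Sigma, forall k, k.1 != set0} ->
  bounded (basis_size Sigma) l.
Proof.
rewrite basis_size_listing => ne; split.
  rewrite -sum1_size !big_seq; apply: leq_sum => i il.
  have /ne : implication_of_seqs i \in Sigma by rewrite inE map_f.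
  case: i il => [[|x xs] W] il //=.
  by case/set0Pn=> x; rewrite inE.
move=> i il; rewrite (big_rem i) //=; lia.
Qed.

End Listing.

Section Correctness.

Variables (d : Order.disp_t) (P : finPOrderType d) (l : seq (seq P * seq P)).
Hypothesis l_uniq : all (fun i => uniq i.1 && uniq i.2) l.
Hypothesis imp_uniq : uniq (map (@implication_of_seqs P) l).
Hypothesis l_canonical :
  canonical_basis (@Co d P) = [set k in map (@implication_of_seqs P) l].

Lemma listed i : i \in l -> exists x y,
  [/\ (x < y)%O, interval x y != set0, [set z in i.1] = [set x; y] &
      [set z in i.2] = interval x y].
Proof.
move=> il; have : implication_of_seqs i \in canonical_basis (@Co d P).
  by rewrite l_canonical inE map_f.
by case/canonical_basisP=> x [y [xy I0 [i1 i2]]]; exists x, y.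
Qed.

Lemma listing x y : (x < y)%O -> interval x y != set0 ->
  exists2 i, i \in l & implication_of_seqs i = ([set x; y], interval x y).
Proof.
move=> xy I0; have : ([set x; y], interval x y) \in canonical_basis (@Co d P).
  by apply/canonical_basisP; exists x, y.
by rewrite l_canonical inE => /mapP[i il ->]; exists i.
Qed.

(** From left to right, an implication [{u, v} -> (u, v)] with [b] in [{u, v}] and
    [c] in [(u, v)] shows [b < c] or [c < b].  Conversely, the implications with
    premises [{b, y}] and [{x, b}] are listed as soon as they are needed, because
    their conclusions contain [c]. *)
Lemma linkedE x y b c : b \in interval x y -> c \in interval x y ->
  linked l b c = (b < c)%O || (c < b)%O.
Proof.
move=> bI cI; move: (bI) (cI); rewrite !inE => /andP[xb by_] /andP[xc cy].
apply/hasP/orP=> [[i il /andP[bi ci]] | [bc | cb]].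
- have [u [v [uv _ i1 i2]]] := listed il.
  have : b \in [set u; v] by rewrite -i1 inE.
  have : c \in interval u v by rewrite -i2 inE.
  by rewrite !inE => /andP[uc cv] /pred2P[->|->]; [left | right].
- have cby : c \in interval b y by rewrite inE bc.
  have [||i il [i1 i2]] := @listing b y => //; first by apply/set0Pn; exists c.
  exists i => //; have := set21 b y; have := cby.
  by rewrite -i1 -i2 !inE => -> ->.
- have cxb : c \in interval x b by rewrite inE xc.
  have [||i il [i1 i2]] := @listing x b => //; first by apply/set0Pn; exists c.
  exists i => //; have := set22 x b; have := cxb.
  by rewrite -i1 -i2 !inE => -> ->.
Qed.

Lemma representatives_pick i x y : i \in l -> [set z in i.2] = interval x y ->
  picks_components (comparability (interval x y)) (interval x y)
                   [set z in representatives (linked l) i.2].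
Proof.
move=> il i2; have /andP[_ u2] := allP l_uniq i il.
have memI z : (z \in i.2) = (z \in interval x y) by rewrite -i2 inE.
have sym : {in i.2 &, symmetric (linked l)}.
  move=> b c; rewrite !memI => bI cI.
  by rewrite (linkedE bI cI) (linkedE cI bI) orbC.
have := representatives_pick_components u2 sym; rewrite i2.
set e := [rel b c | _]; have eE : connect e =2 connect (comparability (interval x y)).
  apply: eq_connect => b c; rewrite /e /comparability /= !memI.
  have [bI|//] := boolP (b \in interval x y).
  have [cI|//] := boolP (c \in interval x y).
  by rewrite (linkedE bI cI).
move=> [sub cover indep]; split=> //.
  by move=> z /cover[r rR rz]; exists r; rewrite // -eE.
by move=> r r' rR r'R; rewrite -eE; exact: indep.
Qed.

Let shrunk_list : seq (seq P * seq P) :=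
  rev [seq (i.1, rev (representatives (linked l) i.2)) | i <- l].

Lemma shrunk_optimum : exists Sigma,
  encodes (tree_of_implications shrunk_list) Sigma /\ is_optimum_basis (@Co d P) Sigma.
Proof.
(* The representatives depend on the order in which the elements are listed, so
   they are looked up in [l] at the position of the implication [k]. *)
pose R k := [set z in representatives (linked l)
               (nth ([::], [::]) l (index k (map (@implication_of_seqs P) l))).2].
have RE i : i \in l ->
    R (implication_of_seqs i) = [set z in representatives (linked l) i.2].
  move=> il; rewrite /R -{1}(nth_index ([::], [::]) il).
  rewrite -(nth_map _ (set0, set0)) ?index_mem // index_uniq ?size_map ?index_mem //.
  by rewrite nth_index.
exists [set (k.1, R k) | k in canonical_basis (@Co d P)]; split; last first.
  apply: shrunk_basis_optimum => x y xy I0; have [i il iE] := listing xy I0.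
  by rewrite -iE RE //; apply: representatives_pick => //; case: iE.
have shrunk_listE : map (@implication_of_seqs P) shrunk_list =
    rev [seq (k.1, R k) | k <- map (@implication_of_seqs P) l].
  rewrite /shrunk_list map_rev -!map_comp; congr rev; apply/eq_in_map => i il /=.
  rewrite RE // /implication_of_seqs /=; congr pair.
  by apply/setP=> z; rewrite !inE mem_rev.
exists shrunk_list; split=> //.
- rewrite /shrunk_list all_rev all_map; apply/allP=> i il /=.
  have /andP[u1 u2] := allP l_uniq i il.
  by rewrite u1 rev_uniq representatives_uniq.
- rewrite shrunk_listE rev_uniq map_inj_in_uniq // => k k'.
  move=> kl k'l [kk' _].
  have : k \in canonical_basis (@Co d P) by rewrite l_canonical inE.
  have : k' \in canonical_basis (@Co d P) by rewrite l_canonical inE.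
  by move=> /imsetP[C' _ ek'] /imsetP[C _ ek]; move: kk'; rewrite ek ek' /= => ->.
apply/setP=> k; rewrite inE shrunk_listE mem_rev l_canonical.
by apply/imsetP/mapP=> -[k' k'l ->]; exists k' => //; move: k'l; rewrite inE.
Qed.

End Correctness.

Theorem corollary27 :
  exists (c : cmd) (p : {poly nat}),
    forall (d : Order.disp_t) (P : finPOrderType d) (v : tree P),
      encodes v (canonical_basis (@Co d P)) ->
      exists (t : nat) (s : store P) (Sigma : {set {set P} * {set P}}),
        [/\ exec c (init_store v) t s,
            t <= (p.[basis_size (canonical_basis (@Co d P))])%R,
            encodes (output s) Sigma &
            is_optimum_basis (@Co d P) Sigma].
Proof.
have [p pE] := optimum_program_time_poly.
exists optimum_program, p => d P v [l [-> l_uniq imp_uniq canonE]].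
have bl : bounded (basis_size (canonical_basis (@Co d P))) l.
  rewrite canonE; apply: bounded_listing => // k; rewrite -canonE.
  by case/canonical_basisP=> x [y [_ _ ->]]; apply/set0Pn; exists x; rewrite set21.
have [t [s [ex tN _ outE]]] := runs_optimum_program bl.
have [Sigma [encS optS]] := shrunk_optimum l_uniq imp_uniq canonE.
by exists t, s, Sigma; split; rewrite // ?pE // outE.
Qed.
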